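(* Let $d\ge 2$ be an integer and $\lambda>0$ a real number. For every finite $d$-regular, vertex-transitive, bipartite (simple) graph $G$, \[ \alpha_G(\lambda)>\alpha_{T_d}(\lambda), \] where $\alpha_G(\lambda)$ is the occupancy fraction of the hard-core model on $G$ at fugacity $\lambda$ and $\alpha_{T_d}(\lambda)$ is the occupancy fraction of the unique translation invariant hard-core measure on the infinite $d$-regular tree $T_d$ at fugacity $\lambda$, that is, the solution $\alpha\in[0,1/2]$ of the equation \[ \frac{\alpha}{\lambda(1-\alpha)}=\left(\frac{1-2\alpha}{1-\alpha}\right)^d . \]
   Context: For a finite graph $G$, let $\mathcal I$ be the set of all independent sets of $G$ (including the empty set), and let $P_G(\lambda)=\sum_{I\in\mathcal I}\lambda^{|I|}$. The hard-core model with fugacity $\lambda$ on $G$ is the random independent set $I$ with $\Pr[I]=\lambda^{|I|}/P_G(\lambda)$. The occupancy fraction is \[ \alpha_G(\lambda)=\frac{1}{|V(G)|}\sum_{v\in V(G)}\Pr[v\in I]=\frac{1}{|V(G)|}\frac{\lambda P_G'(\lambda)}{P_G(\lambda)}. \] The displayed equation in the claim may be taken as the definition of $\alpha_{T_d}(\lambda)$: on $[0,1/2]$ its left side is strictly increasing in $\alpha$ and its right side is strictly decreasing, so there is exactly one solution there. A graph is vertex-transitive if its automorphism group acts transitively on its vertices. *)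

(* Defs.v *)
From mathcomp Require Import all_boot all_order all_fingroup all_algebra.
From mathcomp Require Import classical_sets reals ring lra.

Set Implicit Arguments.
Unset Strict Implicit.
Unset Printing Implicit Defensive.

Import Order.TTheory GRing.Theory Num.Theory.
Local Open Scope ring_scope.

Definition simple_graph (V : finType) (e : rel V) : Prop :=
  symmetric e /\ irreflexive e.

Definition regular (V : finType) (e : rel V) (d : nat) : Prop :=
  forall v : V, #|[set w : V | e v w]| = d.

Definition bipartite (V : finType) (e : rel V) : Prop :=
  exists A : {set V}, forall x y : V, e x y -> (x \in A) != (y \in A).

Definition graph_aut (V : finType) (e : rel V) : {set {perm V}} :=
  [set s : {perm V} | [forall x, forall y, e (s x) (s y) == e x y]].

Lemma graph_aut_group_set (V : finType) (e : rel V) : group_set (graph_aut e).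
Proof.
apply/group_setP; split=> [|s t].
  by rewrite inE; apply/forallP=> x; apply/forallP=> y; rewrite !perm1.
rewrite !inE => /forallP hs /forallP ht.
apply/forallP=> x; apply/forallP=> y; rewrite !permM.
by rewrite (eqP (forallP (ht _) _)) (forallP (hs x) y).
Qed.

Canonical graph_aut_group (V : finType) (e : rel V) : {group {perm V}} :=
  Group (graph_aut_group_set e).

(* [transitive _, on S | _] says that S is a single orbit, so the vertex set
   of a vertex-transitive graph is nonempty. *)
Definition vertex_transitive (V : finType) (e : rel V) : Prop :=
  [transitive graph_aut e, on [set: V] | 'P].

Lemma vertex_transitiveP (V : finType) (e : rel V) :
  vertex_transitive e <->
  (0 < #|V|)%N /\ forall x y : V, exists2 s, s \in graph_aut e & y = s x.
Proof.
rewrite /vertex_transitive; split=> [tr | [/card_gt0P[x0 _] tr]].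
  split=> [|x y]; first by have /imsetP[x _ _] := tr; apply/card_gt0P; exists x.
  by have [s sA ->] := atransP2 tr (finset.in_setT x) (finset.in_setT y); exists s.
apply/imsetP; exists x0 => //; apply/setP=> y; rewrite inE.
by have [s sA ->] := tr x0 y; apply/esym/orbitP; exists s.
Qed.

Definition indep_sets (V : finType) (e : rel V) : {set {set V}} :=
  [set I : {set V} | [forall x in I, forall y in I, ~~ e x y]].

Definition indep_poly (R : realType) (V : finType) (e : rel V) : {poly R} :=
  \sum_(I in indep_sets e) 'X^#|I|.

Definition hardcore (R : realType) (V : finType) (e : rel V) (lam : R)
    (I : {set V}) : R :=
  if I \in indep_sets e then lam ^+ #|I| / (indep_poly R e).[lam] else 0.

Definition occupancy (R : realType) (V : finType) (e : rel V) (lam : R) : R :=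
  #|V|%:R^-1 * \sum_(v : V) \sum_(I : {set V} | v \in I) hardcore e lam I.

Lemma occupancyE (R : realType) (V : finType) (e : rel V) (lam : R) :
  occupancy e lam = #|V|%:R^-1 *
    (lam * (indep_poly R e)^`().[lam] / (indep_poly R e).[lam]).
Proof.
rewrite /occupancy; congr (_ * _).
rewrite (exchange_big_dep xpredT) //= [X in X^`()]/indep_poly raddf_sum /=.
rewrite horner_sum mulr_sumr mulr_suml [RHS]big_mkcond.
apply: eq_bigr => I _; rewrite sumr_const /hardcore.
case: ifP => _; last by rewrite mul0rn.
rewrite derivXn hornerMn hornerXn; case: #|I| => [|n] /=.
  by rewrite !mulr0n mulr0 mul0r.
by rewrite mulrnAr -exprS mulrnAl.
Qed.

Definition tree_occupancy_eq (R : realType) (d : nat) (lam : R) : set R :=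
  fun a => 0 <= a <= 1 / 2 /\
           a / (lam * (1 - a)) = ((1 - 2 * a) / (1 - a)) ^+ d.

(* The occupancy fraction of the translation invariant hard-core measure on the
   infinite d-regular tree. [xget] picks the element of [tree_occupancy_eq],
   which exists and is unique by the two lemmas below. *)
Definition tree_occupancy (R : realType) (d : nat) (lam : R) : R :=
  xget 0 (tree_occupancy_eq d lam).

Lemma tree_occupancy_eq_inj (R : realType) (d : nat) (lam a b : R) :
  (0 < d)%N -> 0 < lam ->
  tree_occupancy_eq d lam a -> tree_occupancy_eq d lam b -> a = b.
Proof.
move=> d0 lam0.
wlog ltab : a b / a < b => [th ha hb|].
  by case: (ltgtP a b) => // h; [apply: th | apply/esym/th].
move=> [/andP[a0 a2] ea] [/andP[b0 b2] eb].
have half1 : 1 / 2 < 1 :> R by rewrite ltr_pdivrMr ?mul1r ?ltr1n ?ltr0n.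
have pa : 0 < 1 - a by rewrite subr_gt0 (le_lt_trans a2).
have pb : 0 < 1 - b by rewrite subr_gt0 (le_lt_trans b2).
have lhs : a / (lam * (1 - a)) < b / (lam * (1 - b)).
  rewrite ltr_pdivrMr ?mulr_gt0 // mulrAC ltr_pdivlMr ?mulr_gt0 //.
  rewrite !(mulrCA _ lam) ltr_pM2l // !mulrBr !mulr1 (mulrC b a).
  by rewrite ltrD2r.
have rhs : (1 - 2 * b) / (1 - b) < (1 - 2 * a) / (1 - a).
  have E c : 0 < 1 - c -> (1 - 2 * c) / (1 - c) = 2 - (1 - c)^-1 :> R.
    move=> pc; have -> : 1 - 2 * c = 2 * (1 - c) - 1 by ring.
    by rewrite mulrBl mulfK ?gt_eqF // mul1r.
  by rewrite !E // ltrD2l ltrN2 ltf_pV2 ?posrE // ltrD2l ltrN2.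
have nb : 0 <= (1 - 2 * b) / (1 - b).
  by rewrite divr_ge0 ?(ltW pb) // subr_ge0 mulrC -ler_pdivlMr ?ltr0n.
move: lhs; rewrite ea eb ltNge ltW // ltrXn2r -?lt0n //.
Qed.

Lemma tree_occupancyP (R : realType) (d : nat) (lam : R) :
  (0 < d)%N -> 0 < lam -> tree_occupancy_eq d lam (tree_occupancy d lam).
Proof.
move=> d0 lam0; suff [a ha] : exists a, tree_occupancy_eq d lam a.
  exact: xgetI ha.
have half1 : 1 / 2 < 1 :> R by rewrite ltr_pdivrMr ?mul1r ?ltr1n ?ltr0n.
pose p : {poly R} := 'X * (1 - 'X) ^+ d - lam *: ((1 - 'X) * (1 - 2 *: 'X) ^+ d).
have pE x : p.[x] = x * (1 - x) ^+ d - lam * ((1 - x) * (1 - 2 * x) ^+ d).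
  by rewrite /p !hornerE.
have p0 : p.[0] <= 0 by rewrite pE !(mulr0, subr0, expr1n, mul0r, mulr1); lra.
have p2 : 0 <= p.[1 / 2].
  rewrite pE (_ : 1 - 2 * (1 / 2) = 0 :> R); last by field.
  rewrite expr0n eqn0Ngt d0 !mulr0 subr0 mulr_ge0 ?exprn_ge0 //; lra.
have [|a /andP[a0 a2] ra] := @poly_ivt _ p 0 (1 / 2) _ (introT andP (conj p0 p2)).
  by lra.
exists a; split; first by rewrite a0.
have pa : 1 - a != 0 by rewrite gt_eqF // subr_gt0 (le_lt_trans a2).
move: ra; rewrite /root pE subr_eq0 => /eqP E.
have lam_neq0 : lam != 0 by rewrite gt_eqF.
rewrite expr_div_n; apply/eqP; rewrite eqr_div ?mulf_neq0 ?expf_neq0 //.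
by rewrite E; apply/eqP; ring.
Qed.

(* Main.v *)
(* By vertex-transitivity every vertex is occupied with the same probability a.
   Conditionally on a fixed vertex v being vacant, each neighbour of v is vacant
   with probability (1 - 2a) / (1 - a), and all of them are vacant with
   probability a / (lam (1 - a)). The neighbours of v lie on one side of the
   bipartition, so their vacancies are positively correlated in G - v:
   a / (lam (1 - a)) >= ((1 - 2a) / (1 - a)) ^ d, and by monotonicity a is at
   least the solution of the equation.

   The correlation inequality is proved by induction on the vertex set: deleting
   a vertex u raises the vacancy probability of the vertices on the side of u and
   lowers it on the other side, because revealing the state of u reduces the
   claim to deleting neighbours of u from a smaller graph. The change is strict
   when u is joined to the vertex by a path. The inequality is therefore strict
   if two neighbours of v are connected in G - v, that is, if v lies on a cycle;
   as all degrees are at least 2, some v does. *)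
Require Import Defs.
From mathcomp Require Import all_boot all_order all_fingroup all_algebra.
From mathcomp Require Import classical_sets reals.
From mathcomp Require Import ring lra.
Import boot.fintype boot.finset.

Set Implicit Arguments.
Unset Strict Implicit.
Unset Printing Implicit Defensive.

Import Order.TTheory GRing.Theory Num.Theory.
Local Open Scope ring_scope.

Lemma setD1_notin (V : finType) (x : V) (S : {set V}) : x \notin S -> S :\ x = S.
Proof. by move=> xS; apply/setDidPl; rewrite disjoint_sym disjoints1. Qed.

(** * Neighbourhoods and independent sets *)

Section Neighbourhoods.
Context {V : finType} (e : rel V).

Definition nbhd (u : V) : {set V} := [set w : V | e u w].

Lemma indep_setsP (I : {set V}) :
  reflect {in I &, forall x y, ~~ e x y} (I \in indep_sets e).
Proof.
rewrite inE; apply: (iffP idP) => [h x y xI yI | h].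
  by move/forall_inP: h => /(_ x xI)/forall_inP/(_ y yI).
by apply/forall_inP=> x xI; apply/forall_inP=> y yI; apply: h.
Qed.

Lemma indep_setsU1 (u : V) (J : {set V}) :
  symmetric e -> irreflexive e ->
  (u |: J \in indep_sets e) = (J \in indep_sets e) && [disjoint J & nbhd u].
Proof.
move=> es ei; apply/indep_setsP/andP => [h | [/indep_setsP hJ dJ] x y].
  split; first by apply/indep_setsP=> x y xJ yJ; rewrite h // !inE ?xJ ?yJ orbT.
  rewrite disjoint_subset; apply/subsetP=> x xJ; rewrite !inE.
  by apply: h; rewrite !inE ?eqxx ?xJ ?orbT.
have hu z : z \in J -> ~~ e u z.
  by move=> zJ; have := disjointFr dJ zJ; rewrite inE => ->.
move=> /setU1P[->|xJ] /setU1P[->|yJ]; rewrite ?ei ?hu //; last exact: hJ.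
by rewrite es hu.
Qed.

End Neighbourhoods.

(** * Partition functions of induced subgraphs *)

Section PartitionFunction.
Context {R : realFieldType} {V : finType} (e : rel V) (lam : R).
Context (hlam : 0 < lam) (es : symmetric e) (ei : irreflexive e).

(** Partition function of the subgraph induced on [S]; deleting vertices becomes a set difference
    over the fixed type [V]. *)
Definition partfun (S : {set V}) : R :=
  \sum_(I in indep_sets e | I \subset S) lam ^+ #|I|.

Local Notation Z := partfun.
Local Notation N := (nbhd e).

Lemma partfun_gt0 (S : {set V}) : 0 < Z S.
Proof.
rewrite /Z (bigD1 set0) /=.
  rewrite cards0 expr0 ltr_pwDl // sumr_ge0 // => I _.
  by rewrite exprn_ge0 // ltW.
by rewrite sub0set andbT; apply/indep_setsP=> x y; rewrite inE.
Qed.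

Lemma partfun_occupied (S : {set V}) (u : V) :
  Z S = Z (S :\ u)
        + \sum_(I in indep_sets e | (I \subset S) && (u \in I)) lam ^+ #|I|.
Proof.
rewrite /Z (bigID (fun I : {set V} => u \in I)) /= addrC; congr (_ + _).
  by apply: eq_bigl => I; rewrite subsetD1 andbA.
by apply: eq_bigl => I; rewrite andbA.
Qed.

(** Removing [u] from the independent sets through [u] leaves exactly those that avoid [u] and its
    neighbours. *)
Lemma partfun_rec (S : {set V}) (u : V) : u \in S ->
  Z S = Z (S :\ u) + lam * Z (S :\ u :\: N u).
Proof.
move=> uS; rewrite (partfun_occupied S u); congr (_ + _).
rewrite /Z mulr_sumr (reindex_onto (fun J => u |: J) (fun I => I :\ u)) /=; last first.
  by move=> I /andP[_ /andP[_ uI]]; rewrite setD1K.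
have E (J : {set V}) :
  (u |: J \in indep_sets e) && ((u |: J \subset S) && (u \in u |: J))
    && ((u |: J) :\ u == J)
  = (J \in indep_sets e) && (J \subset S :\ u :\: N u).
  rewrite indep_setsU1 // setU11 andbT subUset sub1set uS /=.
  rewrite subsetD subsetD1 -!andbA; congr (_ && _).
  rewrite [LHS]andbC -andbA; congr (_ && _); congr (_ && _).
  apply/eqP/idP => [<-|uJ]; first by rewrite !inE eqxx.
  by rewrite setU1K.
apply: eq_big => [J | J]; first exact: E.
rewrite E => /andP[_]; rewrite subsetD subsetD1 => /andP[/andP[_ uJ] _].
by rewrite cardsU1 uJ exprS.
Qed.

(** Probability that [w] is vacant in the hard-core model on the subgraph induced on [S]; it is 1
    for [w] outside [S]. *)
Definition vacancy (w : V) (S : {set V}) : R := Z (S :\ w) / Z S.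

Lemma vacancy_gt0 (w : V) (S : {set V}) : 0 < vacancy w S.
Proof. by rewrite divr_gt0 ?partfun_gt0. Qed.

Lemma vacancy_notin (w : V) (S : {set V}) : w \notin S -> vacancy w S = 1.
Proof.
by move=> wS; rewrite /vacancy setD1_notin // divff // gt_eqF ?partfun_gt0.
Qed.

Lemma vacancy_lt1 (w : V) (S : {set V}) : w \in S -> vacancy w S < 1.
Proof.
move=> wS; rewrite ltr_pdivrMr ?partfun_gt0 // mul1r (partfun_rec wS) ltrDl.
by rewrite mulr_gt0 ?partfun_gt0.
Qed.

Lemma vacancy_le1 (w : V) (S : {set V}) : vacancy w S <= 1.
Proof.
by have [/vacancy_lt1/ltW|/vacancy_notin->] := boolP (w \in S).
Qed.

(* Conditioning on whether [u] is occupied makes [vacancy w S] an average of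
   [vacancy w (S :\ u)] and [vacancy w (S :\ u :\: N u)]. *)
Lemma vacancy_rec (u w : V) (S : {set V}) : u \in S -> u != w ->
  exists2 c, 0 < c & vacancy w S - vacancy w (S :\ u) =
    c * (vacancy w (S :\ u :\: N u) - vacancy w (S :\ u)).
Proof.
move=> uS uw; exists (lam * Z (S :\ u :\: N u) / Z S).
  by rewrite !(mulr_gt0, invr_gt0) ?partfun_gt0.
have uSw : u \in S :\ w by rewrite !inE uw.
have E1 : S :\ w :\ u = S :\ u :\ w by rewrite !setDDl setUC.
have E2 : S :\ w :\ u :\: N u = (S :\ u :\: N u) :\ w.
  by rewrite E1 !setDDl (setUC [set w]).
rewrite /vacancy (partfun_rec uSw) E2 E1 (partfun_rec uS).
have := partfun_gt0 (S :\ u); have := partfun_gt0 (S :\ u :\: N u).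
move: (Z _) (Z (S :\ u)) (Z _) (Z _) => a b c f a0 b0.
field; rewrite !gt_eqF //= addr_gt0 // mulr_gt0 //.
Qed.

(** * Correlation of vacancies in bipartite graphs *)

Section Bipartite.
Context (A : {set V}) (hA : forall x y : V, e x y -> (x \in A) != (y \in A)).

(** A sign, so that the monotonicity statements for the two sides become one inequality. *)
Definition side (u w : V) : R := (-1) ^+ ((u \in A) (+) (w \in A)).

Lemma side_nbhd (u x w : V) : e u x -> side x w = - side u w.
Proof.
move/hA; rewrite /side; case: (u \in A) (x \in A) (w \in A) => [] [] [] //= _;
  by rewrite ?expr0 ?expr1 ?opprK.
Qed.

Lemma side_same (u w : V) : (u \in A) = (w \in A) -> side u w = 1.
Proof. by rewrite /side => ->; rewrite addbb. Qed.

(** Telescoping over single deletions. The hypothesis is confined to subsets of [T] so that an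
    induction on cardinality can supply it. *)
Lemma vacancy_setD_of (w : V) (s : R) (X T : {set V}) :
  (forall (x : V) (S : {set V}), x \in X -> S \subset T ->
     0 <= s * (vacancy w (S :\ x) - vacancy w S)) ->
  0 <= s * (vacancy w (T :\: X) - vacancy w T).
Proof.
move En : #|X| => n; elim: n X T En => [|n IH] X T.
  by move/cards0_eq=> -> _; rewrite setD0 subrr mulr0.
move=> En h; have /card_gt0P[x xX] : (0 < #|X|)%N by rewrite En.
have -> : T :\: X = T :\ x :\: (X :\ x) by rewrite setDDl setD1K.
rewrite -(subrKA (vacancy w (T :\ x))) mulrDr addr_ge0 ?h //.
apply: IH => [|y S]; first by move: En; rewrite (cardsD1 x) xX => -[].
rewrite !inE => /andP[_ yX] ST; apply: h => //.
by apply: subset_trans ST _; rewrite subD1set.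
Qed.

Lemma vacancy_setD1 (u w : V) (S : {set V}) :
  0 <= side u w * (vacancy w (S :\ u) - vacancy w S).
Proof.
move En : #|S| => n; elim: n {-2}n (leqnn n) u w S En => [|n IH] m.
  rewrite leqn0 => /eqP-> u w S /cards0_eq->.
  by rewrite set0D subrr mulr0.
move=> mn u w S Em; have [uS|uS] := boolP (u \in S); last first.
  by rewrite setD1_notin // subrr mulr0.
have [<-|uw] := eqVneq u w.
  rewrite side_same // mul1r subr_ge0 (@vacancy_notin u (S :\ u)) ?vacancy_le1 //.
  by rewrite !inE eqxx.
have [c c0 E] := vacancy_rec uS uw.
(* The minus sign is absorbed by passing to the neighbours of [u], which lie on the other side and
   are deleted from a smaller set. *)
rewrite -opprB E mulrN -mulNr mulrCA mulr_ge0 ?(ltW c0) //.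
apply: vacancy_setD_of => x S'; rewrite inE => ux S'S.
rewrite -(side_nbhd w ux); apply: (IH #|S'|) => //.
have := subset_leq_card S'S; move: mn; rewrite -Em (cardsD1 u S) uS ltnS.
by move=> h1 h2; apply: leq_trans h2 h1.
Qed.

Lemma vacancy_setD (w : V) (s : R) (X T : {set V}) :
  {in X, forall x, side x w = s} ->
  0 <= s * (vacancy w (T :\: X) - vacancy w T).
Proof.
by move=> h; apply: vacancy_setD_of => x S /h <- _; apply: vacancy_setD1.
Qed.

(** Strictness travels along the path: revealing [u] reduces the claim to deleting the next vertex,
    until [w] itself is deleted and its vacancy jumps to 1. *)
Lemma vacancy_setD1_path (u : V) (p : seq V) (S : {set V}) :
  path e u p -> uniq (u :: p) -> {subset u :: p <= S} -> p != [::] ->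
  0 < side u (last u p) * (vacancy (last u p) (S :\ u) - vacancy (last u p) S).
Proof.
elim: p u S => // x p IH u S /= /andP[ux xp] /and3P[uxp xnp up] sub _.
have uS : u \in S by rewrite sub ?inE ?eqxx.
set w := last x p; have wxp : w \in x :: p by rewrite mem_last.
have uw : u != w by apply: contraNneq uxp => ->.
have [c c0 E] := vacancy_rec uS uw.
rewrite -opprB E mulrN -mulNr mulrCA mulr_gt0 // -(side_nbhd w ux).
have sub' : {subset x :: p <= S :\ u}.
  move=> y yp; rewrite in_setD1 (sub y) ?andbT; last by rewrite in_cons yp orbT.
  by apply: contraNneq uxp => <-.
set T := S :\ u.
have xN : x \in N u by rewrite inE.
(* The next path vertex [x] goes first and gives the strict gain; the other neighbours of [u] only
   need the weak bound. *)
have -> : T :\: N u = T :\ x :\: (N u :\ x) by rewrite setDDl setD1K.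
rewrite -(subrKA (vacancy w (T :\ x))) mulrDr ltr_wpDl //.
  apply: vacancy_setD => y; rewrite !inE => /andP[_ uy].
  by rewrite (side_nbhd w uy) (side_nbhd w ux).
have [p0|p0] := eqVneq p [::]; last by apply: IH => //; rewrite /= xnp.
have -> : w = x by rewrite /w p0.
rewrite side_same // mul1r subr_gt0 (@vacancy_notin x (T :\ x)) ?vacancy_lt1 //.
  by rewrite sub' ?inE ?eqxx.
by rewrite !inE eqxx.
Qed.

(** Chain rule: once [x] is vacant the model lives on [S :\ x], where the vacancies on the same side
    are no smaller. *)
Lemma prod_vacancy_le (s : seq V) (S : {set V}) :
  {in s &, forall x y, (x \in A) = (y \in A)} ->
  \prod_(x <- s) vacancy x S <= Z (S :\: [set x in s]) / Z S.
Proof.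
elim: s S => [|x s IH] S h.
  have -> : [set y in [::]] = set0 :> {set V} by apply/setP=> y; rewrite !inE.
  by rewrite big_nil setD0 divff // gt_eqF ?partfun_gt0.
have -> : S :\: [set y in x :: s] = S :\ x :\: [set y in s].
  rewrite setDDl; congr (_ :\: _); apply/setP=> y.
  by rewrite !inE.
have -> : Z (S :\ x :\: [set y in s]) / Z S
    = vacancy x S * (Z (S :\ x :\: [set y in s]) / Z (S :\ x)).
  by rewrite /vacancy; field; rewrite !gt_eqF ?partfun_gt0.
rewrite big_cons ler_pM2l ?vacancy_gt0 //.
apply: (@le_trans _ _ (\prod_(y <- s) vacancy y (S :\ x))); last first.
  by apply: IH => y z ys zs; apply: h; rewrite inE ?ys ?zs orbT.
rewrite !big_seq; apply: ler_prod => y ys; rewrite (ltW (vacancy_gt0 _ _)) /=.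
have := vacancy_setD1 x y S.
by rewrite side_same ?mul1r ?subr_ge0 //; apply: h; rewrite inE ?eqxx ?ys ?orbT.
Qed.

(** Revealing [u] first strictly raises the factor of [w], thanks to the path; the weak inequality
    handles the rest. *)
Lemma prod_vacancy_lt (X : {set V}) (u w : V) (p : seq V) (S : {set V}) :
  {in X &, forall x y, (x \in A) = (y \in A)} ->
  u \in X -> w \in X -> u != w ->
  path e u p -> uniq (u :: p) -> {subset u :: p <= S} -> last u p = w ->
  \prod_(x in X) vacancy x S < Z (S :\: X) / Z S.
Proof.
move=> h uX wX uw up pu sub lp.
have p0 : p != [::] by apply: contraNneq uw => p0; rewrite -lp p0.
have wXu : w \in X :\ u by rewrite !inE eq_sym uw.
rewrite (bigD1 u) //=.
have -> : S :\: X = S :\ u :\: (X :\ u) by rewrite setDDl setD1K.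
have -> : Z (S :\ u :\: (X :\ u)) / Z S
    = vacancy u S * (Z (S :\ u :\: (X :\ u)) / Z (S :\ u)).
  by rewrite /vacancy; field; rewrite !gt_eqF ?partfun_gt0.
rewrite ltr_pM2l ?vacancy_gt0 //.
have le1 y : y \in X -> vacancy y S <= vacancy y (S :\ u).
  move=> yX; have := vacancy_setD1 u y S.
  by rewrite side_same ?mul1r ?subr_ge0 //; apply: h.
apply: (@lt_le_trans _ _ (\prod_(y in X :\ u) vacancy y (S :\ u))).
  rewrite (eq_bigl (mem (X :\ u))); last by move=> y; rewrite !inE andbC.
  rewrite (bigD1 w) //= [ltRHS](bigD1 w) //=.
  have lw : vacancy w S < vacancy w (S :\ u).
    have := vacancy_setD1_path up pu sub p0.
    by rewrite lp side_same ?mul1r ?subr_gt0 //; apply: h.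
  apply: (@lt_le_trans _ _ (vacancy w (S :\ u)
      * \prod_(i in X :\ u | i != w) vacancy i S)).
    rewrite ltr_pM2r //; apply: prodr_gt0 => y _; exact: vacancy_gt0.
  rewrite ler_pM2l ?vacancy_gt0 //; apply: ler_prod => y.
  by rewrite !inE => /andP[/andP[_ yX] _]; rewrite ltW ?vacancy_gt0 ?le1.
have := @prod_vacancy_le (enum (X :\ u)) (S :\ u).
rewrite big_enum set_enum; apply=> y z.
by rewrite !mem_enum !inE => /andP[_ yX] /andP[_ zX]; apply: h.
Qed.

End Bipartite.

End PartitionFunction.

(** * Existence of a vertex on a cycle *)

(** The cycle is recorded as a path between two neighbours of [v] that avoids [v], the form needed
    for strict correlation. *)
Definition on_cycle (V : finType) (e : rel V) (v : V) : Prop :=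
  exists u w : V, exists p : seq V,
    [/\ u \in nbhd e v, w \in nbhd e v, u != w &
     [/\ path e u p, uniq (u :: p), {subset u :: p <= [set~ v]} & last u p = w]].

Lemma path_on_cycle (V : finType) (e : rel V) (x u w : V) (p1 p2 : seq V) :
  path e x (p1 ++ u :: p2) -> uniq (x :: p1 ++ u :: p2) -> w \in p2 ->
  u \in nbhd e x -> w \in nbhd e x -> on_cycle e x.
Proof.
move=> + + wp2 ux wx; case/splitPr: wp2 => p3 p4.
rewrite -(cat_rcons w) -cat_cons !cat_path => /and3P[_ up _].
have {}up : path e u (rcons p3 w) by case/andP: up.
rewrite catA cons_uniq mem_cat negb_or => /andP[/andP[+ _]].
rewrite mem_cat negb_or cat_uniq => /andP[_ xp] /andP[+ _].
rewrite cat_uniq => /and3P[_ _ pu]; exists u, w, (rcons p3 w); split=> //.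
  move: pu => /= /andP[+ _]; apply: contraNneq => ->.
  by rewrite mem_rcons mem_head.
split=> //; last by rewrite last_rcons.
by move=> y yp; rewrite !inE; apply: contraNneq xp => <-.
Qed.

(* The first vertex of a longest path has all its neighbours on that path. *)
Lemma exists_on_cycle (V : finType) (e : rel V) : symmetric e -> irreflexive e ->
  (0 < #|V|)%N -> (forall v, 1 < #|nbhd e v|)%N -> exists v, on_cycle e v.
Proof.
move=> es ei V0 deg.
(* A path with [size p = #|V|] would have [#|V| + 1] distinct vertices. *)
have [//|[x [p [_ /card_uniqP xp sp]]]] : (exists v, on_cycle e v) \/
    exists x p, [/\ path e x p, uniq (x :: p) & size p = #|V|]; last first.
  by have := max_card (mem (x :: p)); rewrite xp /= sp ltnn.
elim: #|V| => [|n [|[x [p [xp pu sp]]]]]; last 2 first.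
- by left.
- have [/exists_inP[y] | ] := boolP [exists y in nbhd e x, y \notin x :: p].
    rewrite inE => xy yp; right; exists y, (x :: p).
    by split; rewrite /= ?sp // ?[e y x]es ?xy // yp.
  rewrite negb_exists_in => /forall_inP sub; left; exists x.
  have {}sub y : y \in nbhd e x -> y \in p.
    move=> yx; have := sub y yx; rewrite negbK inE => /predU1P[E|//].
    by move: yx; rewrite E inE ei.
  have /card_gt1P[u [w [ux wx uw]]] := deg x.
  case/splitPr: (sub u ux) (sub w wx) xp pu => p1 p2.
  (* Whichever of [u] and [w] comes first on the path starts the arc avoiding [x]. *)
  rewrite mem_cat inE eq_sym (negPf uw) /= => /orP[|wp2 xp pu]; last first.
    exact: path_on_cycle xp pu wp2 ux wx.
  case/splitPr=> q1 q2; rewrite -catA /= => xp pu.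
  by apply: path_on_cycle xp pu _ wx ux; rewrite mem_cat mem_head orbT.
by have /card_gt0P[x _] := V0; right; exists x, [::].
Qed.

(** * Occupancy under vertex-transitivity *)

Section VertexTransitive.
Context {R : realType} {V : finType} (e : rel V) (lam : R).

Lemma partfun_setT : partfun e lam [set: V] = (indep_poly R e).[lam].
Proof.
rewrite /partfun /indep_poly horner_sum; apply: eq_big => [I|I _].
  by rewrite subsetT andbT.
by rewrite hornerXn.
Qed.

Lemma partfun_aut (s : {perm V}) (S : {set V}) : s \in graph_aut e ->
  partfun e lam (s @: S) = partfun e lam S.
Proof.
rewrite inE => /forallP hs; have hs' x y : e (s x) (s y) = e x y.
  by have /forallP/(_ y)/eqP := hs x.
rewrite /partfun (reindex_inj (imset_inj (@perm_inj _ s))) /=.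
apply: eq_big => [I | I _]; last by rewrite card_imset //; apply: perm_inj.
congr (_ && _).
  apply/indep_setsP/indep_setsP => h x y.
    by move=> xI yI; rewrite -hs' h // imset_f.
  by case/imsetP=> x' xI -> /imsetP[y' yI ->]; rewrite hs' h.
apply/subsetP/subsetP => h x.
  by move=> xI; rewrite -(mem_imset _ _ (@perm_inj _ s)) h // imset_f.
by case/imsetP=> y yI ->; rewrite imset_f ?h.
Qed.

Lemma occupancy_vertex (v : V) : 0 < lam -> vertex_transitive e ->
  partfun e lam [set~ v] = (1 - occupancy e lam) * partfun e lam [set: V].
Proof.
move=> lam0 /vertex_transitiveP[V0 tr].
have Z0 := partfun_gt0 e lam0 [set: V].
suff -> : occupancy e lam = 1 - partfun e lam [set~ v] / partfun e lam [set: V].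
  by rewrite subKr mulfVK // gt_eqF.
rewrite /occupancy (eq_bigr (fun=> 1 - partfun e lam [set~ v] / partfun e lam [set: V])).
  by rewrite sumr_const -[X in _ * X]mulr_natl mulKf // pnatr_eq0 -lt0n.
move=> w _; have [s sA ->] := tr w v.
have -> : [set~ s w] = s @: [set~ w].
  apply/setP=> x; apply/idP/imsetP => [|[y]]; last first.
    by rewrite !inE => yw ->; rewrite (inj_eq (@perm_inj _ s)).
  rewrite !inE => xw; exists (s^-1 x)%g; last by rewrite permKV.
  by rewrite !inE; apply: contraNneq xw => <-; rewrite permKV.
rewrite partfun_aut // -[1 in RHS](divff (negbT (gt_eqF Z0))) -mulrBl.
rewrite [X in X - _](partfun_occupied e lam [set: V] w) setTD addrC addKr.
rewrite mulr_suml [LHS]big_mkcond [RHS]big_mkcond.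
apply: eq_bigr => I _; rewrite subsetT /= /hardcore -partfun_setT.
by case: (w \in I); case: (I \in indep_sets e).
Qed.

End VertexTransitive.

(** * Comparison with the tree equation *)

Theorem theorem2 (R : realType) (d : nat) (lam : R) (V : finType) (e : rel V)
  (hd : (2 <= d)%N) (hlam : 0 < lam) (hG : simple_graph e)
  (hreg : regular e d) (htrans : vertex_transitive e) (hbip : bipartite e) :
  occupancy e lam > tree_occupancy d lam.
Proof.
have [[es ei] [A hA]] := (hG, hbip).
have /vertex_transitiveP[V0 _] := htrans.
have [|v [u [w [p [uv wv uw [up pu sub lp]]]]]] := exists_on_cycle es ei V0.
  by move=> x; rewrite hreg.
have sameA : {in nbhd e v &, forall x y, (x \in A) = (y \in A)}.
  move=> x y; rewrite !inE => /hA + /hA.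
  by case: (_ \in A) (_ \in A) (_ \in A) => [] [] [].
have := prod_vacancy_lt hlam es ei hA sameA uv wv uw up pu sub lp.
have occ x := occupancy_vertex x hlam htrans.
have vac x : lam * partfun e lam ([set~ x] :\: nbhd e x)
    = occupancy e lam * partfun e lam [set: V].
  have := partfun_rec lam es ei (in_setT x).
  by rewrite setTD occ; lra.
move: (partfun_gt0 e hlam [set: V]) (partfun_gt0 e hlam [set~ v]).
move: (occ v); set a := occupancy e lam.
set Z := partfun e lam [set: V] => Ev Z0; rewrite Ev pmulr_lgt0 // subr_gt0 => a1.
have -> : partfun e lam ([set~ v] :\: nbhd e v) = a * Z / lam.
  by rewrite -(vac v) mulrC mulKf // gt_eqF.
have Evac x : x \in nbhd e v -> vacancy e lam x [set~ v] = (1 - 2 * a) / (1 - a).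
  move=> xv; have xv' : x \in [set~ v].
    by rewrite !inE; apply: contraTneq xv => ->; rewrite inE ei.
  have := partfun_rec lam es ei xv'.
  (* Since [v] is a neighbour of [x], an occupied [x] already excludes [v], so its weight in the
     graph without [v] is still [a * Z]. *)
  have -> : [set~ v] :\ x :\: nbhd e x = [set~ x] :\: nbhd e x.
    apply/setP=> y; rewrite !inE; case: (eqVneq y v) => [->|]; last by rewrite andbT.
    by move: xv; rewrite inE es => ->.
  rewrite vac Ev -/a -/Z => E; rewrite /vacancy Ev.
  have -> : partfun e lam ([set~ v] :\ x) = (1 - 2 * a) * Z by lra.
  by field; rewrite !gt_eqF // subr_gt0.
have r0 : 0 < (1 - 2 * a) / (1 - a) by rewrite -(Evac _ uv) vacancy_gt0.
rewrite (eq_bigr _ Evac) prodr_const (_ : #|_| = d) ?hreg //.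
have -> : a * Z / lam / ((1 - a) * Z) = a / (lam * (1 - a)).
  by field; rewrite !gt_eqF // subr_gt0.
have [] := tree_occupancyP (ltnW hd) hlam; set b := tree_occupancy d lam.
(* If [a <= b], the increasing left side and decreasing right side of the tree equation, equal at
   [b], contradict the strict inequality at [a]. *)
move=> /andP[b0 b2] eb lt_a; rewrite ltNge; apply/negP => leab.
have b1 : 0 < 1 - b by lra.
have {}a1 : 0 < 1 - a by rewrite subr_gt0.
have lhs : a / (lam * (1 - a)) <= b / (lam * (1 - b)).
  rewrite ler_pdivrMr ?mulr_gt0 // mulrAC ler_pdivlMr ?mulr_gt0 //.
  by rewrite !(mulrCA _ lam) ler_pM2l // !mulrBr !mulr1 (mulrC b a) lerD2r.
have rhs : (1 - 2 * b) / (1 - b) <= (1 - 2 * a) / (1 - a).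
  by rewrite ler_pdivrMr // mulrAC ler_pdivlMr //; nra.
move: (lt_le_trans lt_a lhs); rewrite eb ltNge lerXn2r // nnegrE ?(ltW r0) //.
by rewrite divr_ge0 ?(ltW b1) //; lra.
Qed.
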